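(* Let $\mathbb{F}_{243}$ be the field with $243$ elements and let $G_{243,22}=\{x\in\mathbb{F}_{243}: x^{22}=1\}$ be the unique subgroup of order $22$ of $\mathbb{F}_{243}^\times$. For $a,b,c\in G_{243,22}$, we have $a+b+c=0$ if and only if $a=b=c$. *)

(* Defs.v *)
From HB Require Import structures.
From mathcomp Require Import all_boot all_order all_algebra all_fingroup.
From mathcomp Require Import all_solvable all_field.

Set Implicit Arguments.
Unset Strict Implicit.
Unset Printing Implicit Defensive.

Import GRing.Theory.
Local Open Scope ring_scope.

(* For d > 0 the condition x ^+ d = 1 forces x != 0, so rootset F d lies in the
   multiplicative group of F; it is kept as a subset of F because its elements
   are added below. *)
Definition rootset (F : finFieldType) (d : nat) : {set F} :=
  [set x | x ^+ d == 1].

(* When d divides #|F| - 1, rootset F d is the carrier of exactly one group of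
   units, and that group is the only one of order d. *)
Lemma rootset_unique_subgroup (F : finFieldType) (d : nat) :
  (0 < d)%N -> (d %| #|F|.-1)%N ->
  exists H : {group {unit F}},
    [/\ #|H| = d,
        [set FinRing.uval u | u in H] = rootset F d &
        forall K : {group {unit F}}, #|K| = d -> K = H].
Proof.
move=> d_gt0 d_dvd.
have cU : cyclic [set: {unit F}] by apply: field_unit_group_cyclic.
have cardU : #|[set: {unit F}]| = #|F|.-1 by apply: card_finField_unit.
have [H /andP[_ /eqP cH]] : exists H : {group {unit F}},
    (H \subset [set: {unit F}]) && (#|H| == d).
  have [x defU] := cyclicP cU.
  exists <[x ^+ (#|F|.-1 %/ d)]>%G; rewrite subsetT /=.
  have ox : #[x]%g = #|F|.-1 by rewrite orderE -defU.
  have F1 : (0 < #|F|.-1)%N by rewrite -cardU cardG_gt0.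
  rewrite -[#|_|]/(#[x ^+ (#|F|.-1 %/ d)]%g).
  rewrite orderXdiv ox ?dvdn_div //.
  by rewrite divnA // mulKn.
have uniqH (K : {group {unit F}}) : #|K| = d -> K = H.
  move=> cK; apply/val_inj/eqP => /=.
  by rewrite (eq_subG_cyclic cU) ?subsetT // cK cH.
exists H; split=> //; apply/setP=> x; rewrite inE.
apply/imsetP/eqP => [[u uH ->]|xd].
  by rewrite -FinRing.val_unitX -cH expg_cardG.
have Ux : x \is a GRing.unit by rewrite -(unitrX_pos _ d_gt0) xd unitr1.
pose u := FinRing.unit F Ux.
exists u => //.
have ud : (u ^+ d = 1)%g by apply: val_inj; rewrite /= FinRing.val_unitX.
have ou : (#[u]%g %| d)%N by rewrite order_dvdn ud.
rewrite -cycle_subG.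
by rewrite -(cardSg_cyclic cU) ?subsetT // cH.
Qed.

(* Main.v *)
Require Import Defs.
From HB Require Import structures.
From mathcomp Require Import all_boot all_order all_algebra all_fingroup.
From mathcomp Require Import all_solvable all_field.
From mathcomp Require Import ring.

Import GRing.Theory.
Local Open Scope ring_scope.

(* Since 22 = 27 - 5, the Frobenius power x |-> x^27 acts on the 22nd roots of
   unity as x |-> x^5.  Applying it to a + b = -c gives a^5 + b^5 = (a + b)^5,
   that is 5ab(a + b)(a^2 + ab + b^2) = 0, and in characteristic 3 the last
   factor is (a - b)^2. *)

Lemma rootset_neq0 {F : finFieldType} {d : nat} {x : F} :
  (0 < d)%N -> x \in rootset F d -> x != 0.
Proof.
move=> d_gt0; rewrite inE; apply: contraTneq => ->.
by rewrite expr0n gtn_eqF // eq_sym oner_eq0.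
Qed.

Lemma rootset22_exp27 {F : finFieldType} {x : F} :
  x \in rootset F 22 -> x ^+ 27 = x ^+ 5.
Proof. by rewrite inE (exprD x 22 5) => /eqP ->; rewrite mul1r. Qed.

Lemma pchar3_exp27D (F : fieldType) (x y : F) :
  3%N \in [pchar F] -> (x + y) ^+ 27 = x ^+ 27 + y ^+ 27.
(* [27] is matched with [3 ^ 3] by conversion, which makes it a power of the characteristic. *)
Proof. by move=> ch3; apply: (exprDn_pchar x y (n := 27)); rewrite (pnatX _ 3 3) pnatE // ch3. Qed.

(** One equality suffices: the hypotheses are invariant under cyclic rotation of [a], [b], [c]. *)
Lemma rootset22_sum0_eq {F : finFieldType} {a b c : F} :
    3%N \in [pchar F] ->
    a \in rootset F 22 -> b \in rootset F 22 -> c \in rootset F 22 ->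
  a + b + c = 0 -> a = b.
Proof.
move=> ch3 ha hb hc /eqP; rewrite addr_eq0 => /eqP abc.
have three0 : 3%:R = 0 :> F := pcharf0 ch3.
have frob : a ^+ 5 + b ^+ 5 = (a + b) ^+ 5.
  rewrite -(rootset22_exp27 ha) -(rootset22_exp27 hb) -pchar3_exp27D // abc.
  (* What remains is [(- c) ^+ 27 = (- c) ^+ 5]; both exponents are odd, so the sign comes out. *)
  have expNodd n : odd n -> (- c) ^+ n = - c ^+ n.
    by move=> n_odd; rewrite exprNn -signr_odd n_odd mulN1r.
  by rewrite !expNodd // (rootset22_exp27 hc).
have : a * b * c * (a - b) ^+ 2 = 0.
  have -> : c = - (a + b) by rewrite abc opprK.
  (* An identity over the integers, from [5(a^2 + ab + b^2) + (a - b)^2 = 3(2(a^2 + b^2) + ab)]; the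
     multiple of 3 is kept explicit so that [ring] applies before [three0] removes it. *)
  have E : a * b * - (a + b) * (a - b) ^+ 2 =
      (a + b) ^+ 5 - (a ^+ 5 + b ^+ 5)
        - 3%:R * (a * b * (a + b) * (2%:R * (a ^+ 2 + b ^+ 2) + a * b)).
    by ring.
  by rewrite E frob three0 subrr mul0r subr0.
move/eqP; rewrite !mulf_eq0 orbb subr_eq0.
rewrite (negPf (rootset_neq0 _ ha)) // (negPf (rootset_neq0 _ hb)) //.
by rewrite (negPf (rootset_neq0 _ hc)) // => /eqP.
Qed.

Theorem theorem1 (F : finFieldType) (hF : #|F| = 243%N) (a b c : F)
  (ha : a \in rootset F 22) (hb : b \in rootset F 22)
  (hc : c \in rootset F 22) :
  a + b + c = 0 <-> (a = b /\ b = c).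
Proof.
(* Here [243 = 3 ^ 5]. *)
have ch3 : 3%N \in [pchar F] by apply: (card_finPcharP (n := 5)).
split=> [abc0 | [-> ->]].
  split; first exact: rootset22_sum0_eq ch3 ha hb hc abc0.
  by apply: (rootset22_sum0_eq ch3 hb hc ha) => //; rewrite addrC addrA.
by rewrite -mulr2n -mulrSr -mulr_natr (pcharf0 ch3) mulr0.
Qed.
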